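(* Let $\sigma>0$ with $\mathbb{P}(s_1(\Gamma(X))>\sigma)>0$, let $a=(a_j)_{j=1}^n\in\mathbb{R}^n$, and assume that $\rho(a)\in L^p(\Omega)$ for some $p\in[1,+\infty]$. Then $$\|\bar\beta^\sigma-a\|_2\le\mathbb{E}^\sigma\|\beta-a\|_2\le\frac{\sqrt{n}\,m}{\mathbb{P}(s_1(\Gamma(X))>\sigma)^{1/p}}\,\sqrt{K_q^\sigma(\Gamma)}\;\|\rho(a)\|_{L^p(\Omega)},$$ where $q$ is such that $q^{-1}+p^{-1}=1$.
   Context: $(\Omega,\mu)$ is a probability space, $n,m\ge1$ are integers, and $f,\gamma_1,\dots,\gamma_n:\Omega\to\mathbb{R}$ are measurable functions. For $a\in\mathbb{R}^n$ the residue is $\rho(a)(x)=f(x)-\sum_{j=1}^n a_j\gamma_j(x)$. $X=(X^{(1)},\dots,X^{(m)})$ where $X^{(1)},\dots,X^{(m)}$ are i.i.d. random points of $\Omega$ with distribution $\mu$. $F(X)=(f(X^{(1)}),\dots,f(X^{(m)}))^T\in\mathbb{R}^m$, and $\Gamma(X)$ is the random $m\times n$ matrix with entries $\Gamma_{ij}(X)=\gamma_j(X^{(i)})$. $s_1(\Gamma(X))$ is the smallest eigenvalue of the symmetric nonnegative matrix $\Gamma(X)^T\Gamma(X)$ (which is not assumed a.s. invertible). On the event $\{s_1(\Gamma(X))>0\}$, $\beta=(\Gamma(X)^T\Gamma(X))^{-1}\Gamma(X)^TF(X)\in\mathbb{R}^n$. $\mathbb{E}^\sigma$ denotes the expectation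 conditional on the event $\{s_1(\Gamma(X))>\sigma\}$, and $\bar\beta^\sigma=\mathbb{E}^\sigma(\beta)$. For $q\in[1,\infty)$, $K_q^\sigma(\Gamma)=\big[\mathbb{E}^\sigma(s_1(\Gamma(X))^{-q/2})\big]^{2/q}$, and $K_\infty^\sigma(\Gamma)$ is the essential supremum of $s_1(\Gamma(X))^{-1}$ conditionally on $\{s_1(\Gamma(X))>\sigma\}$. Convention $1/\infty=0$; $\|\cdot\|_2$ is the Euclidean norm. *)

(* Defs.v *)
From mathcomp Require Import all_boot all_order all_algebra.
From mathcomp Require Import all_classical all_reals all_analysis.

Set Implicit Arguments.
Unset Strict Implicit.
Unset Printing Implicit Defensive.

Import Order.TTheory GRing.Theory Num.Theory.
Import numFieldNormedType.Exports.

Local Open Scope classical_set_scope.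
Local Open Scope ring_scope.

(* The norm of the library on matrices is the max norm. *)
Definition norm2 (R : realType) (n : nat) (v : 'cV[R]_n) : R :=
  Num.sqrt (\sum_(i < n) v i 0 ^+ 2).

(* For symmetric A of positive size the spectrum is finite and nonempty, so
   that the infimum is the minimum. *)
Definition smallest_eigenvalue (R : realType) (n : nat) (A : 'M[R]_n) : R :=
  inf [set x : R | eigenvalue A x].

Section conditioning.
Context d (T : measurableType d) (R : realType) (P : probability T R).
Local Open Scope ereal_scope.

(* Meaningful for measurable A with P A > 0 and for Y that is nonnegative or
   integrable on A. Only the values of Y on A matter. *)
Definition cond_expectation (A : set T) (Y : T -> \bar R) : \bar R :=
  (\int[P]_(w in A) Y w) / P A.

Definition cond_ess_sup (A : set T) (Y : T -> \bar R) : \bar R :=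
  ereal_inf [set y | {ae P, forall w, A w -> Y w <= y}].

End conditioning.

Section sampling.
Context d (T : measurableType d) (R : realType) (P : probability T R).
Context d' (Omega : measurableType d').
Local Open Scope ereal_scope.

Definition mutually_independent (m : nat) (X : 'I_m -> {RV P >-> Omega}) :=
  forall (J : {set 'I_m}) (B : 'I_m -> set Omega),
    (forall i, measurable (B i)) ->
    P (\bigcap_(i in [set` J]) X i @^-1` B i) =
      \prod_(i in J) P (X i @^-1` B i).

Definition iid_with_law (mu : probability Omega R) (m : nat)
    (X : 'I_m -> {RV P >-> Omega}) :=
  mutually_independent X /\
  forall i (B : set Omega), measurable B -> distribution P (X i) B = mu B.

End sampling.

Section least_squares.
Context (R : realType) (Omega : Type) (n m : nat).
Variables (f : Omega -> R) (gamma : 'I_n -> Omega -> R).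

Definition residue (a : 'cV[R]_n) (x : Omega) : R :=
  f x - \sum_(j < n) a j 0 * gamma j x.

Definition sample_values (x : 'I_m -> Omega) : 'cV[R]_m := \col_i f (x i).

Definition design_matrix (x : 'I_m -> Omega) : 'M[R]_(m, n) :=
  \matrix_(i, j) gamma j (x i).

Definition s1 (x : 'I_m -> Omega) : R :=
  smallest_eigenvalue ((design_matrix x)^T *m design_matrix x).

(* [invmx] is the identity on singular matrices: only meaningful if s1 x > 0. *)
Definition beta (x : 'I_m -> Omega) : 'cV[R]_n :=
  invmx ((design_matrix x)^T *m design_matrix x)
    *m (design_matrix x)^T *m sample_values x.

End least_squares.

Section conditioned_least_squares.
Context d (T : measurableType d) (R : realType) (P : probability T R).
Context d' (Omega : measurableType d') (n m : nat).
Variables (f : Omega -> R) (gamma : 'I_n -> Omega -> R).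
Variable X : 'I_m -> {RV P >-> Omega}.

Definition sample (w : T) : 'I_m -> Omega := fun i => X i w.

Definition good_event (sigma : R) : set T :=
  [set w | sigma < s1 gamma (sample w)].

Definition Esigma (sigma : R) (Y : T -> \bar R) : \bar R :=
  cond_expectation P (good_event sigma) Y.

Definition beta_bar (sigma : R) : 'cV[R]_n :=
  \col_j fine (Esigma sigma (fun w => (beta f gamma (sample w) j 0)%:E)).

(* Only meaningful for 1 <= q <= +oo; the value at -oo is irrelevant. *)
Definition Kconst (sigma : R) (q : \bar R) : \bar R :=
  match q with
  | r%:E => (Esigma sigma
      (fun w => (s1 gamma (sample w) `^ (- (r / 2)))%:E) `^ (2 / r))%E
  | +oo%E => cond_ess_sup P (good_event sigma)
      (fun w => ((s1 gamma (sample w))^-1)%:E)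
  | -oo%E => 0%E
  end.

End conditioned_least_squares.

(* Main.v *)
Require Import Defs.
From mathcomp Require Import all_boot all_order all_algebra.
From mathcomp Require Import all_classical all_reals all_analysis.
From mathcomp Require Import measurable_realfun ess_sup_inf ring lra.

(** Put A = G^T G for the sampled design matrix G, and r for the vector of the
    residues rho(a)(X_i).  The least-squares coefficient vector is affine in
    the data and exact on the span of the gamma_j, so
    beta - a = A^-1 G^T r.  For b = A^-1 G^T r one has
    |G b|^2 = <b, A b> = <G b, r>, hence |G b| <= |r|; as the smallest
    eigenvalue s1 of A is the minimum of the Rayleigh quotient,
    s1 |b|^2 <= |G b|^2, and therefore
    |beta - a| <= s1^(-1/2) |r| <= s1^(-1/2) sum_i |rho(a)(X_i)|
    (beta_error_le).

    Integrate this over the event D = {s1 > sigma}.  Hoelder's inequality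
    applied to the product of 1_D s1^(-1/2) and rho(a)(X_i), together with the
    fact that every X_i has law mu, bounds each of the m terms by
    P(D)^(1/q) sqrt(K_q) |rho(a)|_p; dividing by P(D) turns the power of P(D)
    into P(D)^(-1/p) (conditional_error_le).  As sqrt n >= 1, this is at most
    the asserted bound.

    The first inequality says that the norm of a mean is at most the mean of
    the norm (norm2_Rintegral_le), once |beta - a| is known to be integrable on
    D.  It is, since s1^(-1/2) <= sigma^(-1/2) there and rho(a) is integrable,
    L^p being contained in L^1 for a probability measure.

    Two points need an argument of their own.  The smallest eigenvalue, an
    infimum over the spectrum, must be identified with the minimum of the
    Rayleigh quotient (smallest_eigenvalue_rayleigh).  And the event D must be
    measurable: by density the Rayleigh quotient may be tested on rational
    vectors only, which exhibits {c <= s1} as a countable intersection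
    (measurable_smallest_eigenvalue). *)

Set Implicit Arguments.
Unset Strict Implicit.
Unset Printing Implicit Defensive.

Import Order.TTheory GRing.Theory Num.Theory.
Import numFieldNormedType.Exports.

Local Open Scope classical_set_scope.
Local Open Scope ring_scope.

(** * Rayleigh quotients of symmetric matrices *)

Section quadratic_forms.
Context (R : realType).

Definition bilin n (A : 'M[R]_n) (u v : 'cV[R]_n) : R := (u^T *m A *m v) 0 0.

(** A plain sum rather than the entry of a 1 x 1 matrix, so that positivity and
    linearity follow coordinatewise. *)
Definition dot n (u v : 'cV[R]_n) : R := \sum_(i < n) u i 0 * v i 0.

Lemma dotE n (u v : 'cV[R]_n) : dot u v = (u^T *m v) 0 0.
Proof. by rewrite mxE; apply: eq_bigr => i _; rewrite mxE. Qed.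

Lemma dotC n (u v : 'cV[R]_n) : dot u v = dot v u.
Proof. by apply: eq_bigr => i _; rewrite mulrC. Qed.

Lemma dot_ge0 n (v : 'cV[R]_n) : 0 <= dot v v.
Proof. by apply: sumr_ge0 => i _; rewrite -expr2 sqr_ge0. Qed.

Lemma dot_eq0 n (v : 'cV[R]_n) : (dot v v == 0) = (v == 0).
Proof.
apply/idP/eqP => [|->]; last first.
  by rewrite /dot big1// => i _; rewrite mxE mul0r.
rewrite /dot psumr_eq0 => [/allP v0|i _]; last by rewrite -expr2 sqr_ge0.
apply/matrixP => i j; rewrite ord1 mxE; apply/eqP.
by have := v0 i (mem_index_enum _); rewrite mulf_eq0 orbb.
Qed.

Lemma dot_gt0 n (v : 'cV[R]_n) : v != 0 -> 0 < dot v v.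
Proof. by move=> v0; rewrite lt0r dot_eq0 v0 dot_ge0. Qed.

Lemma norm2_sqr n (v : 'cV[R]_n) : norm2 v ^+ 2 = dot v v.
Proof.
rewrite /norm2 sqr_sqrtr; first by apply: eq_bigr => i _; rewrite expr2.
by apply: sumr_ge0 => i _; rewrite sqr_ge0.
Qed.

Lemma norm2_ge0 n (v : 'cV[R]_n) : 0 <= norm2 v.
Proof. exact: sqrtr_ge0. Qed.

Lemma norm_coord_le n (v : 'cV[R]_n) j : `|v j 0| <= norm2 v.
Proof.
rewrite -sqrtr_sqr ler_sqrt; last by apply: sumr_ge0 => i _; rewrite sqr_ge0.
by rewrite (bigD1 j)//= lerDl; apply: sumr_ge0 => i _; rewrite sqr_ge0.
Qed.

Lemma bilinE n (A : 'M[R]_n) u v : bilin A u v = dot u (A *m v).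
Proof. by rewrite dotE mulmxA. Qed.

Lemma bilin_sym n (A : 'M[R]_n) u v : A^T = A -> bilin A u v = bilin A v u.
Proof.
move=> As; transitivity ((u^T *m A *m v)^T 0 0); first by rewrite mxE.
by rewrite !trmx_mul As trmxK mulmxA.
Qed.

Lemma bilin_gram m n (G : 'M[R]_(m, n)) v :
  bilin (G^T *m G) v v = dot (G *m v) (G *m v).
Proof. by rewrite /bilin dotE trmx_mul !mulmxA. Qed.

Lemma bilin_sum n (A : 'M[R]_n) u v :
  bilin A u v = \sum_i \sum_j A i j * (u i 0 * v j 0).
Proof.
rewrite bilinE; apply: eq_bigr => i _; rewrite mxE mulr_sumr.
by apply: eq_bigr => j _; rewrite mulrCA.
Qed.

Lemma bilinDZ n (A : 'M[R]_n) u v (t : R) : A^T = A ->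
  bilin A (u + t *: v) (u + t *: v) =
  bilin A v v * t ^+ 2 + 2 * bilin A u v * t + bilin A u u.
Proof.
move=> As; have -> : bilin A (u + t *: v) (u + t *: v) =
    ((u^T + t *: v^T) *m A *m (u + t *: v)) 0 0.
  by congr ((_ *m A *m _) 0 0); apply/matrixP => i j; rewrite !mxE.
rewrite !mulmxDl !mulmxDr.
rewrite -!scalemxAl -!scalemxAr.
transitivity (bilin A u u + t * bilin A u v +
    (t * bilin A v u + t * (t * bilin A v v))).
  have addE (B C : 'M[R]_1) : (B + C) 0 0 = B 0 0 + C 0 0 by rewrite mxE.
  have scaleE (s : R) (B : 'M[R]_1) : (s *: B) 0 0 = s * B 0 0 by rewrite mxE.
  by rewrite !addE !scaleE /bilin.
by rewrite (bilin_sym v u As); ring.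
Qed.

(** The quadratic polynomial t |-> bilin A (u + t v) (u + t v) is nonnegative,
    which bounds its discriminant. *)
Lemma cauchy_schwarz n (A : 'M[R]_n) u v : A^T = A ->
  (forall w, 0 <= bilin A w w) ->
  bilin A u v ^+ 2 <= bilin A u u * bilin A v v.
Proof.
move=> As A0.
set a := bilin A u u; set b := bilin A u v; set c := bilin A v v.
have h (t : R) : 0 <= c * t ^+ 2 + 2 * b * t + a by rewrite -bilinDZ.
have c0 : 0 <= c by exact: A0.
have [c00|c0'] := eqVneq c 0.
  rewrite c00 mulr0; have [->|b0] := eqVneq b 0; first by rewrite expr0n.
  (* If c = 0 but b != 0 the polynomial is affine and takes the value -1 here. *)
  have := h (- (a + 1) / (2 * b)); rewrite c00 mul0r add0r mulrCA divff ?mulr1.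
    lra.
  by rewrite mulf_neq0// pnatr_eq0.
have cp : 0 < c by rewrite lt0r c0' c0.
(* -b/c minimizes the polynomial. *)
have := mulr_ge0 c0 (h (- b / c)).
have -> : c * (c * (- b / c) ^+ 2 + 2 * b * (- b / c) + a) = a * c - b ^+ 2.
  by field.
by rewrite subr_ge0.
Qed.

(** A crude bound of the operator norm by the sum of the entries; only its
    finiteness matters. *)
Lemma bilin_le n (A : 'M[R]_n) v :
  `|bilin A v v| <= (\sum_i \sum_j `|A i j|) * dot v v.
Proof.
have le i : v i 0 ^+ 2 <= dot v v.
  rewrite /dot (bigD1 i)//= -expr2 lerDl.
  by apply: sumr_ge0 => j _; rewrite -expr2 sqr_ge0.
rewrite bilin_sum (le_trans (ler_norm_sum _ _ _))// mulr_suml.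
apply: ler_sum => i _; rewrite (le_trans (ler_norm_sum _ _ _))// mulr_suml.
apply: ler_sum => j _; rewrite normrM ler_wpM2l//.
have := le i; have := le j.
by rewrite ler_norml => li lj; apply/andP; split; nra.
Qed.

Lemma dot_cauchy_schwarz n (u v : 'cV[R]_n) : dot u v <= norm2 u * norm2 v.
Proof.
have bilin1 (w w' : 'cV[R]_n) : bilin 1%:M w w' = dot w w'.
  by rewrite bilinE mul1mx.
have uv : dot u v ^+ 2 <= (norm2 u * norm2 v) ^+ 2.
  rewrite exprMn !norm2_sqr -!bilin1.
  by apply: cauchy_schwarz => [|w]; rewrite ?trmx1// bilin1 dot_ge0.
have [uv0|uv0] := leP 0 (dot u v).
  by rewrite -(ler_pXn2r (ltn0Sn 1)) ?nnegrE ?mulr_ge0 ?norm2_ge0.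
by rewrite (le_trans (ltW uv0))// mulr_ge0 ?norm2_ge0.
Qed.

(** Cauchy-Schwarz for M with the vectors v and M v gives
    |M v|^2 <= C <v, M v>, while |v|^2 <= D |M v|^2 because v = M^-1 (M v).
    This replaces a compactness argument on the unit sphere. *)
Lemma psd_unit_coercive n (M : 'M[R]_n) : M^T = M ->
    (forall w, 0 <= bilin M w w) -> M \in unitmx ->
  exists2 c : R, 0 < c & forall v, c * dot v v <= bilin M v v.
Proof.
move=> Ms M0 Mu.
pose C : R := \sum_i \sum_j `|M i j|.
pose N := invmx M; pose D : R := \sum_i \sum_j `|(N^T *m N) i j|.
have C0 : 0 <= C by do 2 (apply: sumr_ge0 => ? _).
have D0 : 0 <= D by do 2 (apply: sumr_ge0 => ? _).
exists (D * C + 1)^-1 => [|v]; first by rewrite invr_gt0; nra.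
have vM : dot v v <= D * dot (M *m v) (M *m v).
  rewrite -[in leLHS](mulKmx Mu v) -[leLHS]bilin_gram.
  exact: (le_trans (ler_norm _) (bilin_le _ _)).
have Mv : dot (M *m v) (M *m v) <= C * bilin M v v.
  set x := dot _ _.
  have x0 : 0 <= x by exact: dot_ge0.
  have [->|xn0] := eqVneq x 0; first by rewrite mulr_ge0.
  have xp : 0 < x by rewrite lt0r xn0.
  have bx : bilin M v (M *m v) = x by rewrite bilin_sym// bilinE.
  have := cauchy_schwarz v (M *m v) Ms M0; rewrite bx expr2 => xx.
  rewrite -(ler_pM2r xp) (le_trans xx)// -mulrA mulrCA ler_wpM2l//.
  exact: (le_trans (ler_norm _) (bilin_le _ _)).
rewrite mulrC ler_pdivrMr; last by nra.
have := ler_wpM2l D0 Mv; have := M0 v; nra.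
Qed.

(** Eigenvalues are defined with row eigenvectors; symmetry allows columns. *)
Lemma eigenvalue_symP n (A : 'M[R]_n) x : A^T = A ->
  reflect (exists2 v : 'cV[R]_n, A *m v = x *: v & v != 0) (eigenvalue A x).
Proof.
move=> As; apply: (iffP eigenvalueP) => -[v Av v0].
  exists v^T; last by rewrite -trmx0 (inj_eq trmx_inj).
  by rewrite -{1}As -trmx_mul Av linearZ.
exists v^T; last by rewrite -trmx0 (inj_eq trmx_inj).
by rewrite -{1}As -trmx_mul Av linearZ.
Qed.

Lemma bilin_shift n (A : 'M[R]_n) (c : R) v :
  bilin (A - c%:M) v v = bilin A v v - c * dot v v.
Proof.
rewrite !bilinE mulmxBl mul_scalar_mx /dot mulr_sumr -sumrB.
by apply: eq_bigr => i _; rewrite !mxE; ring.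
Qed.

Lemma dotZr n (u v : 'cV[R]_n) (c : R) : dot u (c *: v) = c * dot u v.
Proof.
by rewrite /dot mulr_sumr; apply: eq_bigr => i _; rewrite mxE mulrCA.
Qed.

Lemma norm2Z n (c : R) (v : 'cV[R]_n) : norm2 (c *: v) = `|c| * norm2 v.
Proof.
rewrite /norm2 -sqrtr_sqr -sqrtrM ?sqr_ge0// mulr_sumr; congr Num.sqrt.
by apply: eq_bigr => j _; rewrite !mxE exprMn.
Qed.

Lemma bilinZ n (A : 'M[R]_n) (t : R) v :
  bilin A (t *: v) (t *: v) = t ^+ 2 * bilin A v v.
Proof.
rewrite !bilin_sum mulr_sumr; apply: eq_bigr => i _; rewrite mulr_sumr.
by apply: eq_bigr => j _; rewrite !mxE; ring.
Qed.

(** Let l be the infimum of the Rayleigh quotient.  Then A - l is nonnegative,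
    and it cannot be invertible: by psd_unit_coercive it would be bounded below
    by some c > 0, making l + c a lower bound of the quotient.  So l is an
    eigenvalue, and every eigenvalue is a value of the quotient. *)
Lemma smallest_eigenvalue_rayleigh n (A : 'M[R]_n) : (0 < n)%N -> A^T = A ->
  eigenvalue A (smallest_eigenvalue A) /\
  forall v, smallest_eigenvalue A * dot v v <= bilin A v v.
Proof.
move=> n0 As.
pose S := [set bilin A v v | v in [set v : 'cV[R]_n | dot v v = 1]].
have S0 : S !=set0.
  pose i0 : 'I_n := Ordinal n0.
  exists (bilin A (delta_mx i0 0) (delta_mx i0 0)), (delta_mx i0 0) => //=.
  rewrite /dot (bigD1 i0)//= big1 ?addr0 => [|i /negbTE ii0].
    by rewrite !mxE !eqxx mulr1.
  by rewrite !mxE ii0 mulr0.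
have lbS : has_lbound S.
  exists (- (\sum_i \sum_j `|A i j|)) => _ [v /= v1 <-].
  have := bilin_le A v; rewrite v1 mulr1; have := ler_norm (- bilin A v v).
  by rewrite normrN; lra.
pose l := inf S.
have lP v : l * dot v v <= bilin A v v.
  have [->|v0] := eqVneq v 0.
    have /eqP d0 : dot (0 : 'cV[R]_n) 0 == 0 by rewrite dot_eq0.
    by rewrite d0 mulr0 /bilin mulmx0 mxE.
  have vp := dot_gt0 v0.
  pose w := (norm2 v)^-1 *: v.
  have nv2 : (norm2 v)^-1 ^+ 2 = (dot v v)^-1 by rewrite exprVn norm2_sqr.
  have : l <= bilin A w w.
    apply: ge_inf => //; exists w => //=.
    by rewrite dotZr dotC dotZr mulrA -expr2 nv2 mulVf// gt_eqF.
  by rewrite bilinZ nv2 mulrC ler_pdivlMr.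
have el : eigenvalue A l.
  pose M := A - l%:M.
  have Ms : M^T = M by rewrite /M linearB /= As tr_scalar_mx.
  have [//|nel] := boolP (eigenvalue A l); exfalso.
  have Mu : M \in unitmx.
    by rewrite -row_free_unit -kermx_eq0; exact: negbNE nel.
  have [|c c0 cP] := psd_unit_coercive Ms _ Mu.
    by move=> v; rewrite bilin_shift subr_ge0.
  have : l + c <= l.
    apply: lb_le_inf => // _ [v /= v1 <-].
    by have := cP v; rewrite bilin_shift v1; lra.
  by rewrite leNgt ltrDl c0.
have -> : smallest_eigenvalue A = l; last by [].
apply/eqP; rewrite eq_le; apply/andP; split.
  apply: ge_inf => //; exists l => x /= /(eigenvalue_symP _ As)[v Av v0].
  by have := lP v; rewrite bilinE Av dotZr ler_pM2r// dot_gt0.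
apply: lb_le_inf; first by exists l.
move=> x /= /(eigenvalue_symP _ As)[v Av v0].
by have := lP v; rewrite bilinE Av dotZr ler_pM2r// dot_gt0.
Qed.

End quadratic_forms.

(** * Bounds and tests for the smallest eigenvalue *)

Section smallest_eigenvalue_bounds.
Context (R : realType).

Lemma le_smallest_eigenvalueP n (A : 'M[R]_n) (c : R) : (0 < n)%N -> A^T = A ->
  c <= smallest_eigenvalue A <-> forall v, c * dot v v <= bilin A v v.
Proof.
move=> n0 As; have [eA lA] := smallest_eigenvalue_rayleigh n0 As; split.
  by move=> cl v; apply: le_trans (lA v); rewrite ler_wpM2r// dot_ge0.
have [v Av v0] := eigenvalue_symP _ As eA.
by move=> /(_ v); rewrite bilinE Av dotZr ler_pM2r// dot_gt0.
Qed.

Lemma continuous_bilin n (A : 'M[R]_n) :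
  continuous (fun v : 'cV[R]_n => bilin A v v).
Proof.
under eq_fun do rewrite bilin_sum.
move=> v; have Fv : Filter (nbhs v) := nbhs_filter v.
have add_cont := @add_continuous R.
apply: (cvg_big add_cont) => // i _; apply: (cvg_big add_cont) => // j _.
apply: cvgM; first exact: cvg_cst.
by apply: cvgM; exact: coord_continuous.
Qed.

(** The form A - c is continuous, so if it is negative at some vector then it is
    negative at a rational one.  This countable test is what makes the smallest
    eigenvalue a measurable function of the matrix. *)
Lemma le_smallest_eigenvalue_ratP n (A : 'M[R]_n) (c : R) :
  (0 < n)%N -> A^T = A ->
  c <= smallest_eigenvalue A <->
  forall v : 'cV[rat]_n, c * dot (map_mx ratr v) (map_mx ratr v)
                         <= bilin A (map_mx ratr v) (map_mx ratr v).
Proof.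
move=> n0 As; rewrite le_smallest_eigenvalueP//; split=> [h v //|h v].
rewrite leNgt; apply/negP => lv.
have /(@continuous_bilin _ (A - c%:M) v) :
    nbhs (bilin (A - c%:M) v v) [set x | x < 0].
  apply: open_nbhs_nbhs; split; first exact: open_lt.
  by rewrite /= bilin_shift subr_lt0.
move=> /nbhs_ballP[e /= e0 be].
have /all_sig[r rP] (i : 'I_n) : {q : rat | v i 0 < ratr q < v i 0 + e}.
  apply: cid; have /rat_in_itvoo[q] : v i 0 < v i 0 + e by rewrite ltrDl.
  by rewrite in_itv /= => qP; exists q.
pose w : 'cV[rat]_n := \col_i r i.
have : bilin (A - c%:M) (map_mx ratr w) (map_mx ratr w) < 0.
  apply: be; split=> // i j; rewrite /ball /= ord1 !mxE distrC ltr_distl.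
  have /andP[r1 r2] := rP i.
  by rewrite r2 andbT; apply: lt_trans r1; rewrite gtrBl.
by rewrite bilin_shift subr_lt0 ltNge h.
Qed.

Lemma gram_sym m n (G : 'M[R]_(m, n)) : (G^T *m G)^T = G^T *m G.
Proof. by rewrite trmx_mul trmxK. Qed.

Lemma gram_unit m n (G : 'M[R]_(m, n)) : (0 < n)%N ->
  0 < smallest_eigenvalue (G^T *m G) -> G^T *m G \in unitmx.
Proof.
move=> n0 l0.
have [_ lP] := smallest_eigenvalue_rayleigh n0 (gram_sym G).
rewrite -row_free_unit -kermx_eq0; apply/negPn/negP => /rowV0Pn[v].
move=> /sub_kermxP vA v0.
have v0' : v^T != 0 by rewrite -trmx0 (inj_eq trmx_inj).
have := lP v^T; rewrite /bilin trmxK vA mul0mx mxE.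
by rewrite leNgt mulr_gt0// dot_gt0.
Qed.

(** With b = (G^T G)^-1 G^T r one has |G b|^2 = <G b, r>, so |G b| <= |r|, and
    |G b|^2 is the value at b of the form of G^T G. *)
Lemma least_squares_stable m n (G : 'M[R]_(m, n)) (r : 'cV[R]_m) : (0 < n)%N ->
  let l := smallest_eigenvalue (G^T *m G) in 0 < l ->
  norm2 (invmx (G^T *m G) *m G^T *m r) <= (Num.sqrt l)^-1 * norm2 r.
Proof.
move=> n0 l l0.
have Au := gram_unit n0 l0.
have [_ lP] := smallest_eigenvalue_rayleigh n0 (gram_sym G).
set b := _ *m r.
have Ab : G^T *m G *m b = G^T *m r.
  by rewrite /b -[invmx _ *m _ *m r]mulmxA mulKVmx.
have Gb : norm2 (G *m b) ^+ 2 <= norm2 (G *m b) * norm2 r.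
  rewrite norm2_sqr -bilin_gram bilinE Ab.
  have -> : dot b (G^T *m r) = dot (G *m b) r.
    by rewrite [LHS]dotE [RHS]dotE (trmx_mul G b) mulmxA.
  exact: dot_cauchy_schwarz.
have Gbr : norm2 (G *m b) <= norm2 r.
  have [->|Gb0] := eqVneq (norm2 (G *m b)) 0; first exact: norm2_ge0.
  have Gbp : 0 < norm2 (G *m b) by rewrite lt0r Gb0 norm2_ge0.
  by rewrite -(ler_pM2l Gbp) -expr2.
have sl0 : 0 < Num.sqrt l by rewrite sqrtr_gt0.
rewrite ler_pdivlMl// -(ler_pXn2r (ltn0Sn 1)) ?nnegrE ?mulr_ge0 ?norm2_ge0//.
rewrite exprMn sqr_sqrtr ?(ltW l0)// norm2_sqr; apply: (le_trans (lP b)).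
by rewrite bilin_gram -norm2_sqr ler_pXn2r ?nnegrE ?norm2_ge0.
Qed.

Lemma norm2_le_norm1 n (v : 'cV[R]_n) : norm2 v <= \sum_i `|v i 0|.
Proof.
have s0 : 0 <= \sum_i `|v i 0| by apply: sumr_ge0.
rewrite -(ler_pXn2r (ltn0Sn 1)) ?nnegrE ?norm2_ge0// norm2_sqr [leRHS]expr2.
rewrite mulr_suml; apply: ler_sum => i _.
rewrite -expr2 -real_normK ?num_real// expr2 ler_wpM2l//.
by rewrite (bigD1 i)//= lerDl sumr_ge0.
Qed.

End smallest_eigenvalue_bounds.

Section least_squares_error.
Context (R : realType) (Omega : Type) (n m : nat) (n0 : (0 < n)%N).
Context (f : Omega -> R) (gamma : 'I_n -> Omega -> R).

(** The error is the least-squares solution for the residues, because the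
    solution for the data G a is a itself. *)
Lemma beta_error_le (a : 'cV[R]_n) (x : 'I_m -> Omega) : 0 < s1 gamma x ->
  norm2 (beta f gamma x - a) <=
    (Num.sqrt (s1 gamma x))^-1 * \sum_i `|residue f gamma a (x i)|.
Proof.
move=> s0; set G := design_matrix gamma x.
have Au : G^T *m G \in unitmx by exact: gram_unit.
pose r : 'cV[R]_m := \col_i residue f gamma a (x i).
have -> : beta f gamma x - a = invmx (G^T *m G) *m G^T *m r.
  have -> : r = sample_values f x - G *m a.
    apply/matrixP => i j; rewrite !mxE; congr (_ - _).
    by apply: eq_bigr => k _; rewrite !mxE ord1 mulrC.
  rewrite mulmxBr -/(beta f gamma x); congr (_ - _).
  by rewrite mulmxA -(mulmxA _ G^T) mulVmx// mul1mx.
apply: le_trans (least_squares_stable _ n0 s0) _.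
rewrite ler_wpM2l ?invr_ge0 ?sqrtr_ge0// (le_trans (norm2_le_norm1 _))//.
by apply: ler_sum => i _; rewrite mxE.
Qed.

End least_squares_error.

(** * Measurability of matrix-valued functions *)

Section measurable_matrices.
Context d (T : measurableType d) (R : realType).

Definition measurable_mx m n (M : T -> 'M[R]_(m, n)) :=
  forall i j, measurable_fun [set: T] (fun w => M w i j).

Lemma measurable_trmx m n (M : T -> 'M[R]_(m, n)) :
  measurable_mx M -> measurable_mx (fun w => (M w)^T).
Proof. by move=> mM i j; under eq_fun do rewrite mxE; exact: mM. Qed.

Lemma measurable_mulmx m n p (M : T -> 'M[R]_(m, n)) (N : T -> 'M[R]_(n, p)) :
  measurable_mx M -> measurable_mx N -> measurable_mx (fun w => M w *m N w).
Proof.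
move=> mM mN i j; under eq_fun do rewrite mxE.
by apply: measurable_sum => k; apply: measurable_funM; [exact: mM|exact: mN].
Qed.

Lemma measurable_det n (M : T -> 'M[R]_n) :
  measurable_mx M -> measurable_fun [set: T] (fun w => \det (M w)).
Proof.
move=> mM; rewrite /determinant; apply: measurable_sum => s.
apply: measurable_funM => //; apply: measurable_prod => i _; exact: mM.
Qed.

Lemma measurable_adjugate n (M : T -> 'M[R]_n) :
  measurable_mx M -> measurable_mx (fun w => \adj (M w)).
Proof.
move=> mM i j; under eq_fun do rewrite mxE.
apply: measurable_funM => //; apply: measurable_det => k l.
by under eq_fun do rewrite !mxE; exact: mM.
Qed.

Lemma measurable_funV (D : set T) (g : T -> R) :
  measurable_fun D g -> measurable_fun D (fun w => (g w)^-1).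
Proof.
move=> mg.
(* Real powers are measurable, but agree with inversion only on [0, +oo[. *)
have -> : (fun w => (g w)^-1) = (fun w => g w * ((g w) ^+ 2) `^ (-1)).
  apply/funext => w; rewrite powRN powRr1 ?sqr_ge0//.
  have [->|g0] := eqVneq (g w) 0; first by rewrite invr0 mul0r.
  by rewrite expr2 invfM mulVKf.
apply: measurable_funM => //.
apply: (measurableT_comp (measurable_powR (-1))).
exact: measurable_funX.
Qed.

Lemma measurable_smallest_eigenvalue n (M : T -> 'M[R]_n) : (0 < n)%N ->
  (forall w, (M w)^T = M w) -> measurable_mx M ->
  measurable_fun [set: T] (fun w => smallest_eigenvalue (M w)).
Proof.
move=> n0 Ms mM mT; apply: (measurability _ (RGenCInfty.measurableE R)) => //.
move=> _ [_ [c ->] <-].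
pose F (v : 'cV[rat]_n) := [set w | c * dot (map_mx ratr v) (map_mx ratr v)
                         <= bilin (M w) (map_mx ratr v) (map_mx ratr v)].
have mF v : measurable (F v).
  rewrite -[F v]setTI; apply: measurable_fun_le => //.
  under eq_fun do rewrite bilin_sum.
  apply: measurable_sum => i; apply: measurable_sum => j.
  by apply: measurable_funM => //; exact: mM.
rewrite [X in measurable X](_ : _ = \bigcap_k F (odflt 0 (unpickle k))).
  by apply: bigcap_measurableType => k _; exact: mF.
rewrite setTI; apply/seteqP; split => w /=; rewrite in_itv /= andbT.
  by move=> /(le_smallest_eigenvalue_ratP _ n0 (Ms w)) cM k _; exact: cM.
move=> cM; apply/(le_smallest_eigenvalue_ratP _ n0 (Ms w)) => v.
by have := cM (pickle v) I; rewrite /F pickleK.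
Qed.

End measurable_matrices.

Section least_squares_measurability.
Context d (T : measurableType d) (R : realType) (P : probability T R).
Context d' (Omega : measurableType d') (n m : nat) (n0 : (0 < n)%N).
Context (f : Omega -> R) (gamma : 'I_n -> Omega -> R).
Context (mf : measurable_fun [set: Omega] f).
Context (mgamma : forall j, measurable_fun [set: Omega] (gamma j)).
Context (X : 'I_m -> {RV P >-> Omega}).

Lemma measurable_design_matrix :
  measurable_mx (fun w => design_matrix gamma (sample X w)).
Proof.
move=> i j; under eq_fun do rewrite mxE.
exact: (measurableT_comp (mgamma j)).
Qed.

Lemma measurable_gram :
  measurable_mx (fun w => (design_matrix gamma (sample X w))^T
                            *m design_matrix gamma (sample X w)).
Proof.
by apply: measurable_mulmx; first apply: measurable_trmx;
  exact: measurable_design_matrix.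
Qed.

Lemma measurable_s1 : measurable_fun [set: T] (fun w => s1 gamma (sample X w)).
Proof.
apply: measurable_smallest_eigenvalue => // [w|]; first exact: gram_sym.
exact: measurable_gram.
Qed.

Lemma measurable_good_event sigma : measurable (good_event gamma X sigma).
Proof.
rewrite -[good_event _ _ _]setTI /good_event -preimage_itvoy.
exact: measurable_s1 measurableT _ (measurable_itv _).
Qed.

Lemma measurable_residue a : measurable_fun [set: Omega] (residue f gamma a).
Proof.
apply: measurable_funB => //; apply: measurable_sum => j.
exact: measurable_funM.
Qed.

(** On the conditioning event the Gram matrix is invertible, and there its
    inverse is given by Cramer's rule, which is measurable everywhere. *)
Lemma measurable_beta sigma (D := good_event gamma X sigma) i : 0 < sigma ->
  measurable_fun D (fun w => beta f gamma (sample X w) i 0).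
Proof.
move=> sigma0.
pose G w := design_matrix gamma (sample X w).
pose A w := (G w)^T *m G w.
pose b w := \adj (A w) *m (G w)^T *m sample_values f (sample X w).
have mb : measurable_mx b.
  apply: measurable_mulmx; first apply: measurable_mulmx.
  - exact/measurable_adjugate/measurable_gram.
  - exact/measurable_trmx/measurable_design_matrix.
  - move=> k l; under eq_fun do rewrite mxE.
    exact: (measurableT_comp mf).
apply: (@eq_measurable_fun _ _ _ _ D (fun w => (\det (A w))^-1 * b w i 0)).
  move=> w; rewrite inE /D /good_event /= => sw.
  have Au : A w \in unitmx by apply: gram_unit => //; exact: lt_trans sw.
  by rewrite /beta /invmx -/(G w) -/(A w) Au -!scalemxAl [RHS]mxE.
apply: (measurable_funS measurableT) => //; apply: measurable_funM => //.
by apply/measurable_funV/measurable_det/measurable_gram.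
Qed.

End least_squares_measurability.

(** * Hoelder's inequality for extended exponents, and change of variables *)

Section hoelder_all_exponents.
Context d (T : measurableType d) (R : realType) (P : probability T R).
Local Open Scope ereal_scope.

Lemma Lnormy (f : T -> \bar R) : 'N[P]_+oo[f] = ess_sup P (abse \o f).
Proof. by rewrite unlock /Lnorm [X in if _ < X then _ else _](@probability_setT _ T R P) lte01. Qed.

Lemma hoelder_y1 (f g : T -> R) :
  measurable_fun [set: T] f -> measurable_fun [set: T] g ->
  'N[P]_1[EFin \o (f \* g)%R] <= 'N[P]_+oo[EFin \o f] * 'N[P]_1[EFin \o g].
Proof.
move=> mf mg; have mg' : measurable_fun [set: T] (fun w => `|(EFin \o g) w|).
  by apply: measurableT_comp => //; exact/measurable_EFinP.
rewrite !Lnorm1 -ge0_integralZl ?Lnorm_ge0//.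
apply: ae_ge0_le_integral => //.
- apply: measurableT_comp => //; apply/measurable_EFinP.
  exact: measurable_funM.
- by move=> w _; exact: mule_ge0 (Lnorm_ge0 _ _ _) (abse_ge0 _).
- exact: measurable_funeM.
rewrite Lnormy; move: (ess_sup_ge P (abse \o (EFin \o f))).
apply: filterS => w /= fw _.
by rewrite normrM EFinM lee_wpmul2r.
Qed.

Lemma hoelder_conjugates (f g : T -> R) (p q : \bar R) :
  measurable_fun [set: T] f -> measurable_fun [set: T] g ->
  1 <= p -> q^-1 + p^-1 = 1 ->
  'N[P]_1[EFin \o (f \* g)%R] <= 'N[P]_q[EFin \o f] * 'N[P]_p[EFin \o g].
Proof.
move=> mf mg p1 pq.
have pNy : -oo < p by rewrite (lt_le_trans _ p1)// ltNyr.
have p0 : p != 0 by rewrite gt_eqF// (lt_le_trans _ p1).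
have := pq; rewrite addeC => /(hoelder_conjugateP _ pNy p0) qE.
case: p p1 pq pNy p0 qE => [p| |//] p1 pq _ p0 qE.
  have [pE|pn1] := eqVneq p 1%R.
    by rewrite qE pE hoelder_conjugate1; exact: hoelder_y1.
  have {pn1}p1' : (1 < p)%R by rewrite lt_neqAle eq_sym pn1 -lee_fin.
  have p0' : (0 < p)%R by rewrite (lt_trans _ p1').
  move: qE; rewrite /hoelder_conjugate /= !eqe gt_eqF//.
  rewrite -EFinD inver gt_eqF ?subr_gt0// -EFinM => qE.
  rewrite qE; apply: hoelder => //; first by rewrite divr_gt0// subr_gt0.
  by rewrite invf_div; field; rewrite gt_eqF.
rewrite qE hoelder_conjugatey muleC; under eq_Lnorm do rewrite /= mulrC.
exact: hoelder_y1.
Qed.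

End hoelder_all_exponents.

Section law_transfer.
Context d (T : measurableType d) (R : realType) (P : probability T R).
Context d' (Omega : measurableType d') (mu : probability Omega R).
Context (X : {RV P >-> Omega}).
Hypothesis lawX : forall B, measurable B -> distribution P X B = mu B.
Local Open Scope ereal_scope.

Lemma integral_law (h : Omega -> \bar R) : measurable_fun [set: Omega] h ->
  (forall y, 0 <= h y) -> \int[P]_w h (X w) = \int[mu]_y h y.
Proof.
move=> mh h0; rewrite -(ge0_integral_distribution X mh h0).
by apply: eq_measure_integral => A mA _; exact: lawX.
Qed.

(** For finite p this is the change of variables y = X w; for p = +oo, the
    preimage of a mu-null set is P-null. *)
Lemma Lnorm_law (h : Omega -> R) (p : \bar R) : measurable_fun [set: Omega] h ->
  -oo < p -> 'N[P]_p[EFin \o (h \o X)] <= 'N[mu]_p[EFin \o h].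
Proof.
move=> mh; case: p => [p| |//] _.
  rewrite unlock (integral_law (h := fun y => (`|h y| `^ p)%:E))//.
  apply/measurable_EFinP.
  apply: (measurableT_comp (measurable_powR p)).
  exact: measurableT_comp.
rewrite !Lnormy; apply/ess_supP.
have [N [mN muN hN]] := ess_sup_ge mu (abse \o (EFin \o h)).
exists (X @^-1` N); split.
- by rewrite -[_ @^-1` _]setTI; exact: measurable_funPT.
- by rewrite -muN; exact: lawX.
- by move=> w /= hw; exact: hN.
Qed.

End law_transfer.

Section norm2_integral.
Context d (T : measurableType d) (R : realType) (P : {measure set T -> \bar R}).

Lemma measurable_norm2 n (D : set T) (B : T -> 'cV[R]_n) :
  (forall j, measurable_fun D (fun w => B w j 0)) ->
  measurable_fun D (fun w => norm2 (B w)).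
Proof.
move=> mB; apply: (measurableT_comp (f := @Num.sqrt R)).
  by apply: continuous_measurable_fun => x; exact: sqrt_continuous.
by apply: measurable_sum => j; exact: measurable_funX.
Qed.

(** Let v be the vector of the integrals.  Then |v|^2 is the integral of
    <v, B>, hence at most |v| times the integral of |B|. *)
Lemma norm2_Rintegral_le n (D : set T) (B : T -> 'cV[R]_n) : measurable D ->
  (forall j, measurable_fun D (fun w => B w j 0)) ->
  P.-integrable D (EFin \o (fun w => norm2 (B w))) ->
  norm2 (\col_j (\int[P]_(w in D) B w j 0)%R) <= (\int[P]_(w in D) norm2 (B w))%R.
Proof.
move=> mD mB iN; set v := \col_j _.
have iB j : P.-integrable D (EFin \o (fun w => B w j 0)).
  apply: le_integrable iN => //; first exact/measurable_EFinP.
  by move=> w _; rewrite !lee_fin (ger0_norm (norm2_ge0 _)) norm_coord_le.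
have iZ j (c : R) : P.-integrable D (EFin \o (fun w => c * B w j 0)).
  by have := integrableZl mD c (iB j).
have vE : norm2 v ^+ 2 = (\int[P]_(w in D) dot v (B w))%R.
  rewrite norm2_sqr /dot [RHS]/Rintegral.
  under eq_integral do rewrite -sumEFin.
  rewrite integral_sum => [||j]; [|exact: mD|exact: iZ].
  rewrite -sum_fine => [|j _]; last exact: integrable_fin_num (iZ _ _).
  apply: eq_bigr => j _; rewrite -/(Rintegral _ _ _) RintegralZl//.
  by rewrite /v mxE.
have ivN : P.-integrable D (EFin \o (fun w => norm2 v * norm2 (B w))).
  by have := integrableZl mD (norm2 v) iN.
have vle : norm2 v ^+ 2 <= norm2 v * (\int[P]_(w in D) norm2 (B w))%R.
  rewrite vE -RintegralZl//; apply: le_Rintegral => //; last first.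
    by move=> w _; exact: dot_cauchy_schwarz.
  rewrite /dot (_ : _ \o _ = fun w => (\sum_j (v j 0 * B w j 0)%:E)%E).
    by apply: integrable_sum => // j _; exact: iZ.
  by apply/funext => w /=; rewrite sumEFin.
have [->|v0] := eqVneq (norm2 v) 0.
  by apply: Rintegral_ge0 => w _; exact: norm2_ge0.
have vp : 0 < norm2 v by rewrite lt0r v0 norm2_ge0.
by rewrite -(ler_pM2l vp) -expr2.
Qed.

End norm2_integral.

(** * The conditional error *)

Section conditioned_error.
Context d (T : measurableType d) (R : realType) (P : probability T R).
Context d' (Omega : measurableType d') (mu : probability Omega R).
Context (n m : nat) (n0 : (0 < n)%N).
Context (f : Omega -> R) (gamma : 'I_n -> Omega -> R).
Context (mf : measurable_fun [set: Omega] f).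
Context (mgamma : forall j, measurable_fun [set: Omega] (gamma j)).
Context (X : 'I_m -> {RV P >-> Omega}).
Context (lawX : forall i B, measurable B -> distribution P (X i) B = mu B).
Context (sigma : R) (sigma0 : 0 < sigma).

Local Notation D := (good_event gamma X sigma).
Local Notation s1X w := (s1 gamma (sample X w)).

Context (PD0 : (0 < P D)%E).

(** The factor s1^(-1/2) extended by 0 outside the conditioning event, so that
    Hoelder's inequality can be used on the whole space. *)
Definition weight (w : T) : R := \1_D w * s1X w `^ (- 2^-1).

Lemma weight_ge0 w : 0 <= weight w.
Proof. by rewrite mulr_ge0// powR_ge0. Qed.

Lemma s1_gt0 w : D w -> 0 < s1X w.
Proof. exact: lt_trans. Qed.

Let mD : measurable D.
Proof. exact: measurable_good_event. Qed.

Lemma measurable_weight : measurable_fun [set: T] weight.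
Proof.
apply: measurable_funM; first exact: measurable_indic.
apply: (measurableT_comp (measurable_powR (- 2^-1))).
exact: measurable_s1.
Qed.

Lemma weightE w : D w -> weight w = (Num.sqrt (s1X w))^-1.
Proof.
move=> Dw; rewrite /weight indicE mem_set// mul1r powRN powR12_sqrt//.
exact: ltW (s1_gt0 Dw).
Qed.

Lemma beta_error_weight_le a w : D w ->
  norm2 (beta f gamma (sample X w) - a) <=
    \sum_i `|weight w * residue f gamma a (X i w)|.
Proof.
move=> Dw; apply: (le_trans (beta_error_le n0 f a (s1_gt0 Dw))).
rewrite mulr_sumr -weightE//; apply: ler_sum => i _.
by rewrite normrM (ger0_norm (weight_ge0 _)).
Qed.

Lemma measurable_beta_error a j :
  measurable_fun D (fun w => (beta f gamma (sample X w) - a) j 0).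
Proof.
rewrite (_ : (fun w => _) = (fun w => beta f gamma (sample X w) j 0 - a j 0)).
  by apply: measurable_funB => //; exact: measurable_beta.
by apply/funext => w; rewrite !mxE.
Qed.

Local Open Scope ereal_scope.

Let c := fine (P D).

Let PDE : P D = c%:E.
Proof. by rewrite fineK// fin_num_measure. Qed.

Let c0 : (0 < c)%R.
Proof. by rewrite -lte_fin -PDE. Qed.

(** For finite q this is an equality: the integral of s1^(-q/2) over D is P(D)
    times its conditional expectation. *)
Lemma Lnorm_weight_le (q : \bar R) : 1 <= q ->
  'N[P]_q[EFin \o weight] <= P D `^ fine q^-1 * sqrte (Kconst gamma X sigma q).
Proof.
case: q => [q| |//]; rewrite ?lee_fin => q1.
  have q0 : (0 < q)%R by exact: lt_le_trans q1.
  rewrite unlock /Kconst /Esigma /cond_expectation.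
  set I := \int[P]_(w in D) _.
  have I0 : 0 <= I by apply: integral_ge0 => w _; rewrite lee_fin powR_ge0.
  have -> : \int[P]_w `|(EFin \o weight) w| `^ q = I.
    rewrite /I [RHS]integral_mkcond; apply: eq_integral => w _ /=.
    rewrite ger0_norm ?weight_ge0// patchE; case: ifPn => [|wD].
      rewrite inE => Dw.
      by rewrite /weight indicE mem_set// mul1r -powRrM mulNr mulrC.
    by rewrite /weight indicE (negbTE wD) mul0r powR0// gt_eqF.
  have IE : I = P D * (I / P D).
    by rewrite PDE inver gt_eqF// muleC -muleA -EFinM mulVf ?gt_eqF// mule1.
  rewrite {1}IE inver gt_eqF// poweRM//; last first.
    by rewrite mule_ge0// inve_ge0.
  rewrite -poweR12_sqrt ?poweR_ge0// -poweRrM.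
  by rewrite (_ : (2 / q * 2^-1 = q^-1)%R)//; field; rewrite gt_eqF.
rewrite invey /= poweRe0 mul1e Lnormy; apply/ess_supP.
(* A conditional essential supremum is an ordinary one, of the function
   extended by -oo. *)
rewrite /Kconst (_ : cond_ess_sup _ _ _ =
  ess_sup P (fun w => if w \in D then (s1X w)^-1%:E else -oo)); last first.
  congr ereal_inf; apply/seteqP; split=> y /=; apply: filterS => w.
    by case: ifPn => // wD; [apply; rewrite inE in wD|rewrite leNye].
  by move=> + Dw; rewrite mem_set.
set K := ess_sup _ _; move: (ess_sup_ge P
  (fun w => if w \in D then (s1X w)^-1%:E else -oo)).
apply: filterS => w /=; case: ifPn => [|wD _]; last first.
  by rewrite /weight indicE (negbTE wD) mul0r normr0 sqrte_ge0.
rewrite inE => Dw wK; rewrite ger0_norm ?weight_ge0// weightE//.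
rewrite -sqrtrV ?(ltW (s1_gt0 Dw))// -[leLHS]/(sqrte (s1X w)^-1%:E).
by rewrite lee_sqrt// (le_trans _ wK)// lee_fin invr_ge0 ltW// s1_gt0.
Qed.

(** Each sample point contributes P(D)^(1/q) sqrt(K_q) |rho(a)|_p to the integral
    over D, and dividing by P(D) leaves P(D)^(-1/p) in place of P(D)^(1/q). *)
Lemma conditional_error_le a (p q : \bar R) :
    1 <= p -> q^-1 + p^-1 = 1 ->
  Esigma gamma X sigma
     (fun w => (norm2 (beta f gamma (sample X w) - a))%:E)
     <= m%:R%:E / P D `^ fine p^-1 * sqrte (Kconst gamma X sigma q)
        * 'N[mu]_p[EFin \o residue f gamma a].
Proof.
move=> p1 pq; set rho := residue f gamma a.
have mrho : measurable_fun [set: Omega] rho by exact: measurable_residue.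
have pNy : -oo < p by rewrite (lt_le_trans _ p1)// ltNyr.
have p0 : p != 0 by rewrite gt_eqF// (lt_le_trans _ p1).
have q1 : 1 <= q.
  have := pq; rewrite addeC => /(hoelder_conjugateP _ pNy p0) ->.
  exact: hoelder_conj_ge1.
have uv : (fine q^-1 + fine p^-1 = 1)%R.
  have : q^-1 + p^-1 \is a fin_num by rewrite pq.
  by rewrite fin_numD => /andP[qf pf]; rewrite -fineD// pq.
set u := fine q^-1 in uv *; set v := fine p^-1 in uv *.
set K := sqrte _; set N := 'N[mu]_p[_].
have mX i : measurable_fun [set: T] (rho \o X i) by exact: measurableT_comp.
have term i : \int[P]_(w in D) `|weight w * rho (X i w)|%:E <=
    (c `^ u)%:E * K * N.
  apply: (@le_trans _ _ 'N[P]_1[EFin \o (weight \* (rho \o X i))%R]).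
    rewrite Lnorm1; apply: ge0_subset_integral => //.
    apply/measurable_EFinP; apply: measurableT_comp => //.
    exact: measurable_funM measurable_weight (mX i).
  apply: le_trans (hoelder_conjugates P measurable_weight (mX i) p1 pq) _.
  apply: lee_pmul; rewrite ?Lnorm_ge0//.
    by have := Lnorm_weight_le q1; rewrite PDE.
  exact: (Lnorm_law (lawX i) mrho pNy).
have total : \int[P]_(w in D) (norm2 (beta f gamma (sample X w) - a))%:E <=
    m%:R%:E * ((c `^ u)%:E * K * N).
  apply: (@le_trans _ _
      (\int[P]_(w in D) \sum_i `|weight w * rho (X i w)|%:E)).
    apply: ge0_le_integral => //.
    - by move=> w _; rewrite lee_fin norm2_ge0.
    - apply/measurable_EFinP/measurable_norm2 => j.
      exact: measurable_beta_error.
    - apply: emeasurable_sum => i; apply/measurable_EFinP.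
      apply: (measurable_funS measurableT) => //; apply: measurableT_comp => //.
      exact: measurable_funM measurable_weight (mX i).
    - by move=> w Dw; rewrite sumEFin lee_fin beta_error_weight_le.
  rewrite ge0_integral_sum//; last first.
    move=> i; apply/measurable_EFinP.
    apply: (measurable_funS measurableT) => //; apply: measurableT_comp => //.
    exact: measurable_funM measurable_weight (mX i).
  apply: (@le_trans _ _ (\sum_(i < m) (c `^ u)%:E * K * N)).
    by apply: lee_sum => i _; exact: term.
  by rewrite mule_natl big_const card_ord /enatmul Monoid.iteropE.
rewrite /Esigma /cond_expectation.
(* The conjugacy of p and q enters here, with u = 1/q and v = 1/p. *)
have cv : (c `^ u / c = (c `^ v)^-1)%R.
  rewrite -powRN -[X in (_ / X)%R](powRr1 (ltW c0)) -powRN -powRD; last first.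
    by apply/implyP => _; rewrite gt_eqF.
  by congr (_ `^ _)%R; rewrite -uv; ring.
apply: (@le_trans _ _ (m%:R%:E * ((c `^ u)%:E * K * N) / P D)).
  by rewrite lee_wpmul2r// inve_ge0.
rewrite PDE poweR_EFin !inver gt_eqF// gt_eqF ?powR_gt0//.
rewrite -cv EFinM -!muleA (muleA K) (muleC (K * N)).
exact: lexx.
Qed.

Lemma integrable_beta_error a : residue f gamma a \in Lfun mu 1 ->
  P.-integrable D
    (EFin \o (fun w => norm2 (beta f gamma (sample X w) - a))).
Proof.
move=> rho1; set rho := residue f gamma a.
have mrho : measurable_fun [set: Omega] rho by exact: measurable_residue.
have irho i : P.-integrable D (EFin \o (fun w => `|rho (X i w)|%R)).
  apply: (integrableS measurableT) => //.
  apply/integrableP; split.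
    apply/measurable_EFinP; apply: measurableT_comp => //.
    exact: measurableT_comp.
  have /integrableP[_] : mu.-integrable [set: Omega] (EFin \o rho).
    exact/Lfun1_integrable.
  rewrite -(integral_law (lawX i)) //; last first.
    by apply: measurableT_comp => //; exact/measurable_EFinP.
  by under [X in _ -> X < _]eq_integral do rewrite /= normr_id.
have isum : P.-integrable D
    (fun w => ((Num.sqrt sigma)^-1)%:E * \sum_i `|rho (X i w)|%:E).
  by apply: integrableZl => //; apply: integrable_sum => // i _; exact: irho.
apply: le_integrable isum => //.
  apply/measurable_EFinP/measurable_norm2 => j.
  exact: measurable_beta_error.
move=> w Dw; rewrite sumEFin -EFinM !abse_EFin lee_fin.
rewrite ger0_norm ?norm2_ge0// (le_trans _ (ler_norm _))//.
apply: (le_trans (beta_error_le n0 f a (s1_gt0 Dw))).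
apply: ler_wpM2r; first by apply: sumr_ge0.
rewrite lef_pV2 ?posrE ?sqrtr_gt0 ?(s1_gt0 Dw)//.
by rewrite ler_sqrt ?(ltW (s1_gt0 Dw))// ltW.
Qed.

Lemma conditional_mean_error_le a : residue f gamma a \in Lfun mu 1 ->
  (norm2 (beta_bar f gamma X sigma - a))%:E <=
  Esigma gamma X sigma (fun w => (norm2 (beta f gamma (sample X w) - a))%:E).
Proof.
move=> rho1.
pose B w := (beta f gamma (sample X w) - a)%R.
have iB := integrable_beta_error rho1.
have mB j : measurable_fun D (fun w => (B w j 0)%R).
  exact: measurable_beta_error.
have iBj j : P.-integrable D (EFin \o (fun w => (B w j 0)%R)).
  apply: le_integrable iB => //; first exact/measurable_EFinP.
  by move=> w _; rewrite !lee_fin (ger0_norm (norm2_ge0 _)) norm_coord_le.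
have ia j : P.-integrable D (EFin \o cst (a j 0)%R).
  exact: finite_measure_integrable_cst.
pose v := \col_j (\int[P]_(w in D) B w j 0)%R.
have betaE j : (fun w => (beta f gamma (sample X w) j 0)%R%:E) =
    (EFin \o (fun w => (B w j 0)%R)) \+ (EFin \o cst (a j 0)%R).
  by apply/funext => w /=; rewrite -EFinD !mxE subrK.
have -> : (beta_bar f gamma X sigma - a = c^-1 *: v)%R.
  apply/matrixP => j k; rewrite ord1 !mxE /Esigma /cond_expectation betaE.
  rewrite integralD// PDE inver gt_eqF// fineM//; last first.
    by rewrite fin_numD !integrable_fin_num.
  rewrite fineD ?integrable_fin_num// -/(Rintegral P D (fun w => (B w j 0)%R)).
  rewrite -/(Rintegral P D (cst (a j 0)%R)) Rintegral_cst// -/c /=.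
  by field; rewrite gt_eqF.
rewrite norm2Z gtr0_norm ?invr_gt0//.
rewrite /Esigma /cond_expectation PDE inver gt_eqF//.
rewrite -(fineK (integrable_fin_num mD iB)) -EFinM lee_fin mulrC.
apply: ler_wpM2r; first by rewrite invr_ge0 ltW.
exact: (norm2_Rintegral_le mD mB iB).
Qed.

End conditioned_error.

Theorem proposition4p1 (R : realType)
    (dO : measure_display) (Omega : measurableType dO) (mu : probability Omega R)
    (n m : nat) (n_ge1 : (1 <= n)%N) (m_ge1 : (1 <= m)%N)
    (f : Omega -> R) (gamma : 'I_n -> Omega -> R)
    (mf : measurable_fun [set: Omega] f)
    (mgamma : forall j, measurable_fun [set: Omega] (gamma j))
    (dT : measure_display) (T : measurableType dT) (P : probability T R)
    (X : 'I_m -> {RV P >-> Omega}) (iidX : iid_with_law mu X)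
    (sigma : R) (sigma_gt0 : 0 < sigma)
    (Psigma : (0 < P (good_event gamma X sigma))%E)
    (a : 'cV[R]_n) (p q : \bar R) (p_ge1 : (1 <= p)%E)
    (rhoLp : residue f gamma a \in Lfun mu p)
    (pq : (q^-1 + p^-1 = 1)%E) :
  ((norm2 (beta_bar f gamma X sigma - a))%:E
     <= Esigma gamma X sigma
          (fun w => (norm2 (beta f gamma (sample X w) - a))%:E))%E
  /\
  (Esigma gamma X sigma
     (fun w => (norm2 (beta f gamma (sample X w) - a))%:E)
     <= (Num.sqrt n%:R * m%:R)%:E
          / P (good_event gamma X sigma) `^ fine p^-1
        * sqrte (Kconst gamma X sigma q)
        * 'N[mu]_p[EFin \o residue f gamma a])%E.
Proof.
have [_ lawX] := iidX.
split.
  apply: (conditional_mean_error_le n_ge1 mf mgamma lawX) => //.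
  by apply: (Lfun_subset _ p_ge1) rhoLp => //; rewrite fin_num_measure.
apply: le_trans (conditional_error_le n_ge1 mf mgamma lawX
  sigma_gt0 Psigma a p_ge1 pq) _.
apply: lee_wpmul2r; first exact: Lnorm_ge0.
apply: lee_wpmul2r; first exact: sqrte_ge0.
apply: lee_wpmul2r; first by rewrite inve_ge0 poweR_ge0.
rewrite lee_fin ler_peMl//.
by rewrite -[leLHS]sqrtr1 ler_sqrt ?ler0n// ler1n.
Qed.
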